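(* For every $N\in\mathbb{N}$ the coefficients of the polynomial $B_N(z)$ lie in $\mathbb{Z}$. If $N'$ divides $N$ in $\mathbb{Z}$ (with $N,N'\in\mathbb{N}$), then $B_{N'}(z)$ divides $B_N(z)$ in $\mathbb{Z}[z]$.
   Context: Setting: $n\ge 1$, $\mathfrak{A}\subset\mathbb{Z}^n$ is a finite set, and $c_{\mathsf a}$ ($\mathsf a\in\mathfrak{A}$) are positive integers. $\Lambda\subset\mathbb{Z}^n$ is the lattice spanned over $\mathbb{Z}$ by all differences $\mathsf a-\mathsf b$ with $\mathsf a,\mathsf b\in\mathfrak{A}$; it is assumed throughout that $\Lambda$ has rank $n$. The dual lattice is $\Lambda^\vee=\{\mathsf t\in\mathbb{R}^n \mid \langle \mathsf t,\lambda\rangle\in\mathbb{Z}\ \forall\lambda\in\Lambda\}$. Let $\widehat{\mathcal D}(\mathsf t)=\sum_{\mathsf a\in\mathfrak{A}}c_{\mathsf a}e^{-2\pi i\langle \mathsf t,\mathsf a\rangle}$ for $\mathsf t\in\mathbb{R}^n$; the function $|\widehat{\mathcal D}(\mathsf t)|^2$ is $\Lambda^\vee$-periodic. For $N\in\mathbb{N}$ (positive integers) and $r\in\mathbb{R}$ let $\mathrm{mult}_N(r)=\#\{\mathsf t\in\frac1N\Lambda^\vee/\Lambda^\vee \mid |\widehat{\mathcal D}(\mathsf t)|^2=r\}$ and $B_N(z)=\prod_{r\in\mathbb{R}}(z-r)^{\mathrm{mult}_N(r)}$. Equivalently, $B_N(z)=\prod_{\mathsf x\in\mathrm{Hom}(\Lambda,\mu_N)}(z-W(\mathsf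 x))$, where $\mu_N\subset\mathbb{C}^*$ is the group of $N$-th roots of unity and $W(\mathsf x)=\sum_{\mathsf a,\mathsf b\in\mathfrak{A}}c_{\mathsf a}c_{\mathsf b}\,\mathsf x(\mathsf a-\mathsf b)$. *)

(* Defs.v *)
From HB Require Import structures.
From mathcomp Require Import all_boot all_order all_algebra finmap.
From mathcomp Require Import all_classical all_reals all_analysis.
From mathcomp Require Import complex.

Set Implicit Arguments.
Unset Strict Implicit.
Unset Printing Implicit Defensive.

Import Order.TTheory GRing.Theory Num.Theory.

Local Open Scope classical_set_scope.
Local Open Scope complex_scope.
Local Open Scope ring_scope.

Definition difference_lattice n (A : {fset 'rV[int]_n}) : set 'rV[int]_n :=
  [set l | exists k : 'rV[int]_n -> 'rV[int]_n -> int,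
     l = \sum_(a <- A) \sum_(b <- A) (a - b) *~ k a b].

Definition Zindependent (V : zmodType) m (v : 'I_m -> V) : Prop :=
  forall k : 'I_m -> int, \sum_(i < m) v i *~ k i = 0 -> forall i, k i = 0.

Definition has_Zrank (V : zmodType) (L : set V) (r : nat) : Prop :=
  (exists2 v : 'I_r -> V, (forall i, L (v i)) & Zindependent v) /\
  (forall m (v : 'I_m -> V),
     (forall i, L (v i)) -> Zindependent v -> (m <= r)%N).

Section SpectralPolynomial.
Variables (R : realType) (n : nat).
Implicit Types (A : {fset 'rV[int]_n}) (c : 'rV[int]_n -> nat).

Definition pairing (t : 'rV[R]_n) (l : 'rV[int]_n) : R :=
  \sum_(i < n) t ord0 i * (l ord0 i)%:~R.

Definition dual_lattice (L : set 'rV[int]_n) : set 'rV[R]_n :=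
  [set t | forall l, L l -> pairing t l \is a Num.int].

(* [exp (i x)]; R[i] carries no complex exponential. *)
Definition expi (x : R) : R[i] := cos x +i* sin x.

Definition Dhat A c (t : 'rV[R]_n) : R[i] :=
  \sum_(a <- A) (c a)%:R * expi (- (2 * pi * pairing t a)).

(* Translation cosets, as elements of the power set of the ambient group. *)
Definition coset_of_set (V : zmodType) (L : set V) (t : V) : set V :=
  [set t + s | s in L].

Definition scaled_dual (N : nat) (L : set 'rV[int]_n) : set 'rV[R]_n :=
  [set N%:R^-1 *: s | s in dual_lattice L].

(* The condition on [t] depends only on its class modulo the dual lattice,
   since [|Dhat|^2] is periodic.  The set of classes is finite when the
   difference lattice has rank [n]; [fset_set] sends infinite sets to the
   empty set. *)
Definition mult_N A c (N : nat) (r : R) : nat :=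
  let L := difference_lattice A in
  #|` fset_set [set coset_of_set (dual_lattice L) t | t in
       scaled_dual N L `&` [set t | Normc.normc (Dhat A c t) ^+ 2 = r]] |.

(* Only finitely many of the factors differ from 1: [mult_N A c N r] is nonzero
   only for the values [r] of [|Dhat|^2] on a finite group. *)
Definition B_poly A c (N : nat) : {poly R} :=
  \big[*%R/1]_(r \in [set: R]) ('X - r%:P) ^+ mult_N A c N r.

End SpectralPolynomial.

(* Main.v *)
(* Pairing with a [Z]-basis of [Lambda] identifies [(1/N) Lambda^vee / Lambda^vee]
   with [(Z/N)^n], and on this group [|Dhat|^2] becomes the Fourier transform of an
   integral function.  Multiplication by that function in the group ring of
   [(Z/N)^n] is an integral matrix diagonalised by the characters, so [B_N] is its
   characteristic polynomial and has integral coefficients.  If [N'] divides [N],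
   the cosets counted at level [N'] are among those counted at level [N]; hence
   [B_N'] divides [B_N] over the reals, and the quotient by a monic integral
   polynomial is integral. *)
Require Import Defs.
From HB Require Import structures.
From mathcomp Require Import all_boot all_order all_algebra finmap.
From mathcomp Require Import all_classical all_reals all_analysis.
From mathcomp Require Import complex.
From mathcomp Require Import ring lra zify.

Set Implicit Arguments.
Unset Strict Implicit.
Unset Printing Implicit Defensive.

Import Order.TTheory GRing.Theory Num.Theory.

Local Open Scope ring_scope.

(** * The character of R/Z and its orthogonality relations *)

Section Turn.
Variable R : realType.
Implicit Types x y : R.

(* [exp (- 2 i pi x)] *)
Definition turn x : R[i] := expi (- (2 * pi * x)).

Lemma turnD x y : turn (x + y) = turn x * turn y.
Proof.
rewrite /turn mulrDr opprD /expi cosD sinD.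
by apply/eqP; rewrite eq_complex /= eqxx; apply/eqP; ring.
Qed.

Lemma turn0 : turn 0 = 1.
Proof. by rewrite /turn mulr0 oppr0 /expi cos0 sin0. Qed.

Lemma turnN x : turn (- x) = conjc (turn x).
Proof. by rewrite /turn mulrN /expi /conjc cosN sinN. Qed.

Lemma turn_sum I (r : seq I) (P : pred I) (F : I -> R) :
  turn (\sum_(i <- r | P i) F i) = \prod_(i <- r | P i) turn (F i).
Proof. exact: (big_morph turn turnD turn0). Qed.

Lemma turnMn x m : turn (x *+ m) = turn x ^+ m.
Proof. by elim: m => [|m IH]; rewrite ?mulr0n ?turn0 // mulrS turnD IH exprS. Qed.

Lemma turn_int x : x \is a Num.int -> turn x = 1.
Proof.
have turn_nat m : turn m%:R = 1.
  have t1 : turn 1 = 1.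
    by rewrite /turn mulr1 mulr_natl /expi cosN sinN cos2pi sin2pi oppr0.
  by rewrite turnMn t1 expr1n.
case/intrP => -[m|m] ->; first exact: turn_nat.
by rewrite NegzE mulrNz turnN turn_nat conjc1.
Qed.

Lemma eq_turn x y : x - y \is a Num.int -> turn x = turn y.
Proof. by move=> xy; rewrite -[x](subrK y) turnD turn_int ?mul1r. Qed.

(** If [cos (2 pi y) = 1] then [sin (pi y) = 0], but the sine is positive on the open interval from
    0 to [pi]. Conjugation reduces negative [x] to this case. *)
Lemma turn_neq1 x : 0 < `|x| < 1 -> turn x != 1.
Proof.
have pos y : 0 < y < 1 -> turn y != 1.
  case/andP => y0 y1; apply/eqP => /(congr1 (@complex.Re R)) /=.
  rewrite cosN -mulrA mulr_natl cos_mulr2n => c1.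
  have : 0 < sin (pi * y).
    by rewrite sin_gt0_pi // mulr_gt0 ?pi_gt0 //= gtr_pMr ?pi_gt0.
  have /eqP := cos2Dsin2 (pi * y).
  have -> : cos (pi * y) ^+ 2 = 1 by lra.
  by rewrite -subr_eq0 addrAC subrr add0r sqrf_eq0 => /eqP ->; rewrite ltxx.
case: (ger0P x) => [_|_ xb]; first exact: pos.
apply: contra_neq (pos _ xb) => tx.
by rewrite turnN tx conjc1.
Qed.

(** A geometric sum whose ratio [z] is an N-th root of unity. For [k != l] the ratio differs from 1,
    and multiplying by [z - 1] gives [z ^+ N - 1 = 0]. *)
Lemma sum_turn N (k l : 'I_N) :
  \sum_(h < N) turn ((k%:R - l%:R) / N%:R * h%:R) = (k == l)%:R * N%:R.
Proof.
have N0 : (0 < N%:R :> R) by rewrite ltr0n (leq_ltn_trans (leq0n k)).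
have [->|kl] := eqVneq k l.
  rewrite subrr mul0r (eq_bigr (fun=> 1)) ?sumr_const ?card_ord ?mul1r //.
  by move=> h _; rewrite mul0r turn0.
set z := turn ((k%:R - l%:R) / N%:R).
have z1 : z != 1.
  apply: turn_neq1; rewrite normrM normfV [X in _ / X]gtr0_norm //.
  rewrite divr_gt0 ?normr_gt0 ?subr_eq0 ?eqr_nat //= ltr_pdivrMr // mul1r.
  have [/ltW lN kN] : (l%:R < N%:R :> R) /\ (k%:R < N%:R :> R) by rewrite !ltr_nat.
  have := ler0n R k; have := ler0n R l => ? ?.
  by rewrite ltr_norml; apply/andP; split; have := ltr_nat R l N; rewrite ltn_ord; lra.
apply/(mulfI (x := z - 1)); first by rewrite subr_eq0.
rewrite mul0r mulr0 (eq_bigr (fun h : 'I_N => z ^+ h)) => [|h _].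
  rewrite -subrX1 -turnMn -[X in turn X]mulr_natr divfK ?gt_eqF //.
  by rewrite turn_int ?subrr // rpredB ?rpred_nat.
by rewrite mulr_natr turnMn.
Qed.

End Turn.

(** The hypothesis gives [('X - A) V = V ('X - diag d)]. Taking determinants and cancelling [\det V]
    in the integral domain of polynomials avoids inverting [V]. *)
Lemma char_poly_eigenbasis (F : idomainType) m (A V : 'M[F]_m) (d : 'rV_m) :
  \det V != 0 -> A *m V = V *m diag_mx d ->
  char_poly A = \prod_(i < m) ('X - (d 0 i)%:P).
Proof.
move=> V0 AV; have V0' : \det (map_mx polyC V) != 0.
  by rewrite det_map_mx polyC_eq0.
apply: (mulIf V0'); rewrite /char_poly -det_mulmx /char_poly_mx.
rewrite mulmxBl -map_mxM AV map_mxM -scalar_mxC -mulmxBr det_mulmx mulrC.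
congr (_ * _); set D := (X in \det X).
have -> : D = diag_mx (\row_i ('X - (d 0 i)%:P)).
  apply/matrixP => i j; rewrite !mxE; case: eqP => [->|_]; first by rewrite !mulr1n.
  by rewrite !mulr0n /= subr0.
by rewrite det_diag; apply: eq_bigr => i _; rewrite mxE.
Qed.

(** * Characters of (Z/N)^n and integral convolution matrices *)

Section Torus.
Variables (R : realType) (n p : nat).
Local Notation N := p.+1.
Local Notation G := {ffun 'I_n -> 'I_N}.

Definition residues (v : 'I_n -> int) : G :=
  [ffun i => inord (absz (v i %% N)%Z)].

Lemma residues_sub v i : ((v i)%:~R - (residues v i)%:R) / N%:R \is a (@Num.int R).
Proof.
have rN : ((v i %% N)%Z = residues v i :> int).
  rewrite ffunE inordK; first by rewrite gez0_abs // modz_ge0.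
  have := ltz_pmod (v i) (isT : 0 < N%:Z); have := modz_ge0 (v i) (isT : N%:Z != 0).
  by lia.
by rewrite {1}(divz_eq (v i) N) rN intrD intrM addrK mulfK ?pnatr_eq0.
Qed.

Definition dot (k : G) (v : 'I_n -> int) : R :=
  \sum_i (k i)%:R / N%:R * (v i)%:~R.

Lemma dotD k v w : dot k (fun i => v i + w i) = dot k v + dot k w.
Proof. by rewrite -big_split /=; apply: eq_bigr => i _; rewrite intrD mulrDr. Qed.

(** The characters are well defined on (Z/N)^n: reducing [v] modulo N changes [dot k v] by an
    integer. *)
Lemma turn_dot_residues k v :
  turn (dot k (fun i => (residues v i : nat)%:Z)) = turn (dot k v).
Proof.
apply/esym/eq_turn; rewrite -sumrB rpred_sum // => i _.
rewrite -mulrBr mulrAC -mulrA rpredM ?rpred_nat //; exact: residues_sub.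
Qed.

Definition fourier_mx : 'M[R[i]]_#|{: G}| :=
  \matrix_(g, k) turn (dot (enum_val k) (fun i => ((enum_val g : G) i : nat)%:Z)).

(** Orthogonality of characters: the conjugate transpose [U] is an inverse up to the nonzero scalar
    [N ^+ n]. *)
Lemma det_fourier_mx : \det fourier_mx != 0.
Proof.
pose U : 'M[R[i]]_#|{: G}| := \matrix_(k, g)
  turn (- dot (enum_val k) (fun i => ((enum_val g : G) i : nat)%:Z)).
have UV : U *m fourier_mx = ((N%:R) ^+ n)%:M.
  apply/matrixP => k l; rewrite !mxE.
  transitivity (\sum_(g : G) \prod_i
     turn ((((enum_val l : G) i)%:R - ((enum_val k : G) i)%:R) / N%:R * (g i)%:R) : R[i]).
    rewrite [RHS](reindex _ (onW_bij _ (@enum_val_bij _))) /=.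
    apply: eq_bigr => g _; rewrite !mxE -turnD -turn_sum addrC -sumrB.
    congr turn; apply: eq_bigr => i _.
    by rewrite -mulrBl -mulrBl.
  (* The sum over the group factors into one sum per coordinate; a coordinate where [k] and [l]
     differ makes the product vanish. *)
  rewrite -(bigA_distr_bigA (fun i (h : 'I_N) =>
    turn ((((enum_val l : G) i)%:R - ((enum_val k : G) i)%:R) / N%:R * h%:R) : R[i])) /=.
  rewrite (eq_bigr _ (fun i _ => sum_turn R _ _)) big_split /= prodr_const card_ord.
  have [->|kl] := eqVneq k l.
    by rewrite big1 ?mul1r ?mulr1n // => i _; rewrite eqxx.
  have [i il] : exists i, (enum_val l : G) i != (enum_val k : G) i.
    apply/existsP; rewrite -negb_forall; apply: contra_neqN kl => /forallP lk.
    by apply/enum_val_inj/ffunP => i; apply/esym/eqP.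
  by rewrite (bigD1 i) //= (negbTE il) !mul0r mulr0n.
apply/negP => /eqP V0; have /eqP := congr1 determinant UV.
rewrite det_mulmx V0 mulr0 det_scalar eq_sym !expf_eq0 pnatr_eq0 /=.
by rewrite !andbF.
Qed.

(* The matrix [M] of the proof represents multiplication by [\sum_x w x [e x]]
   in the group ring of [(Z/N)^n]. *)
Lemma prod_char_int (I : Type) (s : seq I) (w : I -> nat) (e : I -> 'I_n -> int) :
  exists b : {poly int}, map_poly intr b =
    \prod_(k : G) ('X - (\sum_(x <- s) (w x)%:R * turn (dot k (e x)))%:P).
Proof.
pose shift (g : G) v := residues (fun i => (g i : nat)%:Z + v i).
pose M : 'M[int]_#|{: G}| := \matrix_(g, h)
  \sum_(x <- s) (w x * (enum_val h == shift (enum_val g) (e x)))%:Z.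
pose W (k : G) : R[i] := \sum_(x <- s) (w x)%:R * turn (dot k (e x)).
exists (char_poly M); rewrite map_char_poly.
rewrite (char_poly_eigenbasis (d := \row_k W (enum_val k)) det_fourier_mx).
  rewrite [RHS](reindex _ (onW_bij _ (@enum_val_bij _))) /=.
  by apply: eq_bigr => k _; rewrite mxE.
apply/matrixP => g k; rewrite mul_mx_diag !mxE.
transitivity (\sum_(h : G) \sum_(x <- s) (w x)%:R *
    (h == shift (enum_val g) (e x))%:R *
    turn (dot (enum_val k) (fun i => (h i : nat)%:Z)) : R[i]).
  rewrite [RHS](reindex _ (onW_bij _ (@enum_val_bij _))) /=.
  apply: eq_bigr => h _; rewrite !mxE rmorph_sum /= mulr_suml.
  by apply: eq_bigr => x _; rewrite -natrM.
rewrite exchange_big mulr_sumr /=; apply: eq_bigr => x _.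
(* Only [h = g + e x] contributes, and there the character splits into its value at [g] times its
   value at [e x], the latter being a summand of the eigenvalue. *)
rewrite (bigD1 (shift (enum_val g) (e x))) //= eqxx mulr1 big1 ?addr0 => [|h].
  by rewrite turn_dot_residues dotD turnD mulrCA.
by move=> /negbTE ->; rewrite mulr0 mul0r.
Qed.

End Torus.

(** * A Z-basis of the difference lattice *)

Section Lattice.
Variables (n : nat) (A : {fset 'rV[int]_n}).
Local Notation L := (difference_lattice A).

Lemma difference_lattice_lincomb I (r : seq I) (v : I -> 'rV[int]_n) (k : I -> int) :
  (forall i, L (v i)) -> L (\sum_(i <- r) v i *~ k i).
Proof.
move=> Lv; elim: r => [|i r IH].
  rewrite big_nil; exists (fun _ _ => 0).
  by rewrite big1 // => a _; rewrite big1 // => b _; rewrite mulr0z.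
rewrite big_cons; have [f ->] := Lv i; have [g ->] := IH.
exists (fun a b => f a b * k i + g a b).
rewrite mulrz_suml -big_split /=; apply: eq_bigr => a _.
rewrite mulrz_suml -big_split /=; apply: eq_bigr => b _.
by rewrite mulrzDr mulrzA.
Qed.

Lemma difference_lattice_sub a b : a \in A -> b \in A -> L (a - b).
Proof.
move=> aA bA; exists (fun x y => ((x == a) && (y == b))%:Z).
rewrite (big_fsetD1 a) //= [X in _ = _ + X]big1_seq ?addr0 => [|x]; last first.
  rewrite in_fsetD1 /= => /andP[/negbTE xa _]; rewrite big1 // => y _.
  by rewrite xa mulr0z.
rewrite (big_fsetD1 b) //= !eqxx /= [X in _ = _ + X]big1_seq ?addr0 // => y.
by rewrite in_fsetD1 /= => /andP[/negbTE yb _]; rewrite yb mulr0z.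
Qed.

Lemma difference_lattice_rows : exists m (M : 'M[int]_(m, n)),
  forall l, L l <-> exists k, l = k *m M.
Proof.
pose s := [seq (a, b) | a <- A, b <- A].
pose v (i : 'I_(size s)) := (tnth (in_tuple s) i).1 - (tnth (in_tuple s) i).2.
have rowE (k : 'rV_(size s)) : k *m \matrix_i v i = \sum_i v i *~ k 0 i.
  by rewrite mulmx_sum_row; apply: eq_bigr => i _; rewrite rowK -[in LHS](intz (_ 0 _)) scaler_int.
exists (size s), (\matrix_i v i) => l; split => [[k ->]|[k ->]].
  exists (\row_i k (tnth (in_tuple s) i).1 (tnth (in_tuple s) i).2).
  rewrite rowE -(big_allpairs (F := fun x => (x.1 - x.2) *~ k x.1 x.2)) big_tnth.
  by apply: eq_bigr => i _; rewrite mxE.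
rewrite rowE; apply: difference_lattice_lincomb => i.
have /allpairsP[[a b] [/= aA bA ab]] := mem_tnth i (in_tuple s).
by rewrite /v ab; apply: difference_lattice_sub.
Qed.

(** In the Smith form of a generating matrix [M], the rows of the diagonal part times [V] generate
    the same lattice. The [n] independent vectors given by the rank are integral combinations of
    these rows, which forces [\det B != 0]. *)
Lemma difference_lattice_basis : has_Zrank L n -> exists B : 'M[int]_n,
  \det B != 0 /\ forall l, L l <-> exists k, l = k *m B.
Proof.
case=> -[v Lv vfree] _; have [m [M LM]] := difference_lattice_rows.
have [U unitU [V unitV [d _ defM]]] := int_Smith_normal_form M.
pose J : 'M[int]_(m, n) := \matrix_(i, j) (i == j :> nat)%:R.
(* The factor [(j < m)] puts zeros on the diagonal beyond the row count of [M], so that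
   [\det B != 0] will yield [n <= m]. *)
pose D : 'rV[int]_n := \row_j (d`_j * (j < m)%:R).
pose B := diag_mx D *m V.
have MB : M = U *m J *m B.
  rewrite defM /B !mulmxA -(mulmxA U J); congr (_ *m _ *m _).
  apply/matrixP => i j; rewrite mul_mx_diag !mxE.
  by case: eqP => [<-|_]; rewrite ?mulr0n ?mul0r // mulr1n mul1r ltn_ord mulr1.
have [K vK] : exists K, (\matrix_i v i) = K *m B.
  have /choice[k kP] i : exists k, v i = k *m M by apply/LM/Lv.
  exists ((\matrix_i k i) *m (U *m J)); rewrite -mulmxA -MB.
  by apply/row_matrixP => i; rewrite row_mul !rowK.
have B0 : \det B != 0.
  suff : \det (\matrix_i v i) != 0.
    by rewrite vK det_mulmx; apply: contraNneq => ->; rewrite mulr0.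
  apply/det0P => -[u /negP u0 uv]; apply: u0; apply/eqP/rowP => i; rewrite mxE.
  apply: (vfree (u 0)); rewrite -[RHS]uv mulmx_sum_row.
  by apply: eq_bigr => j _; rewrite rowK -[in RHS](intz (_ 0 _)) scaler_int.
exists B; split=> // l; split=> [/LM[k ->]|[k ->]].
  by exists (k *m (U *m J)); rewrite -mulmxA -MB.
(* Since [M = U J B], this witness gives [k J^T J B], and [J^T J = 1] because [n <= m]. *)
apply/LM; exists (k *m J^T *m invmx U); rewrite -mulmxA.
rewrite MB -!mulmxA mulKmx //; congr (_ *m _); rewrite mulmxA.
suff -> : J^T *m J = 1%:M by rewrite mul1mx.
have jm (j : 'I_n) : (j < m)%N.
  move: B0; rewrite det_mulmx mulf_eq0 negb_or => /andP[+ _].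
  rewrite det_diag => /prodf_neq0/(_ j isT); rewrite mxE.
  by case: (j < m)%N => //; rewrite mulr0 eqxx.
apply/matrixP => i j; rewrite !mxE (bigD1 (Ordinal (jm i))) //= big1 => [|h].
  by rewrite !mxE /= eqxx mul1r addr0.
by rewrite -val_eqE !mxE => /negbTE /= ->; rewrite mul0r.
Qed.

End Lattice.

(** Uniqueness of division: with [h] and [r] the quotient and remainder over the integers,
    [r = (q - h) * d] over the reals. A nonzero multiple of the monic [d] cannot be shorter than
    [d], so [q = h]. *)
Lemma int_poly_quotient (R : realType) (b d : {poly int}) (q : {poly R}) :
  map_poly intr d \is @monic R -> map_poly intr b = q * map_poly intr d ->
  q \is a polyOver Num.int.
Proof.
move=> mon_d bqd; have inj : injective (intr : int -> R) by exact: intr_inj.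
have d_mon : d \is monic.
  move: mon_d; rewrite !monicE lead_coef_map_inj // => /eqP d1.
  by apply/eqP/inj; rewrite d1.
have b_div := Pdiv.RingMonic.rdivp_eq d_mon b.
set h := Pdiv.Ring.rdivp b d in b_div; set r := Pdiv.Ring.rmodp b d in b_div.
suff -> : q = map_poly intr h.
  by apply/polyOverP => i; rewrite coef_map intr_int.
apply/eqP; rewrite -subr_eq0; apply: contraTT isT => qh.
have rE : map_poly intr r = (q - map_poly intr h) * map_poly intr d.
  by rewrite mulrBl -bqd {1}b_div rmorphD rmorphM /= addrAC subrr add0r.
have := Pdiv.Ring.ltn_rmodp b d; rewrite monic_neq0 // -/r.
rewrite -(size_map_inj_poly inj) // rE size_Mmonic // size_map_inj_poly //.
have : (0 < size (q - map_poly intr h)%R)%N by rewrite size_poly_gt0.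
by case: (size _) => // k _; rewrite addSn ltnNge leq_addl.
Qed.

(** * Equality of cosets of a subgroup *)

Section Cosets.
Variables (V : zmodType) (D : set V).
Hypotheses (D0 : D 0) (DB : forall x y, D x -> D y -> D (x - y)).

Lemma coset_of_set_eq s t : coset_of_set D s = coset_of_set D t <-> D (s - t).
Proof.
have DN x : D x -> D (- x) by move=> Dx; rewrite -sub0r; apply: DB.
have DD x y : D x -> D y -> D (x + y).
  by move=> Dx Dy; rewrite -(opprK y); apply/DB/DN.
split=> [st|Dst].
  have : coset_of_set D s s by exists 0; rewrite ?addr0.
  by rewrite st => -[u Du <-]; rewrite addrAC subrr add0r.
apply/seteqP; split=> _ [u Du <-].
  by exists (s - t + u); [exact: DD | rewrite addrA addrCA subrr addr0].
exists (u - (s - t)); first exact: DB.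
by rewrite opprB addrCA [s + _]addrCA subrr addr0 addrC.
Qed.

End Cosets.

(** * The dual lattice in coordinates, and periodicity of the spectral function *)

Section DualLattice.
Variables (R : realType) (n : nat) (A : {fset 'rV[int]_n}) (c : 'rV[int]_n -> nat).
Variables (B : 'M[int]_n).
Hypothesis B_unit : \det B != 0.
Hypothesis B_basis : forall l, difference_lattice A l <-> exists k, l = k *m B.
Local Notation L := (difference_lattice A).
Local Notation D := (dual_lattice L : set 'rV[R]_n).
Implicit Types s t : 'rV[R]_n.

(** The pairing of [t] with the [i]-th row of [B], that is, the coordinate of [t] in the dual basis;
    the dual lattice becomes Z^n. *)
Definition coords t i : R := (t *m (map_mx intr B)^T) 0 i.

Lemma coordsB s t i : coords (s - t) i = coords s i - coords t i.
Proof. by rewrite /coords mulmxBl !mxE. Qed.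

Lemma coordsZ x t i : coords (x *: t) i = x * coords t i.
Proof. by rewrite /coords -scalemxAl mxE. Qed.

Lemma pairing_coords t k : pairing t (k *m B) = \sum_i coords t i * (k 0 i)%:~R.
Proof.
rewrite /pairing; under eq_bigr do rewrite mxE rmorph_sum /= mulr_sumr.
rewrite exchange_big; apply: eq_bigr => i _; rewrite /coords mxE mulr_suml.
by apply: eq_bigr => j _; rewrite !mxE rmorphM /= mulrCA mulrC.
Qed.

Lemma dual_latticeP t : D t <-> forall i, coords t i \is a Num.int.
Proof.
split=> [Dt i|Dt l /B_basis[k ->]].
  have /Dt : L (delta_mx 0 i *m B) by apply/B_basis; exists (delta_mx 0 i).
  rewrite pairing_coords (bigD1 i) //= big1 => [|j /negbTE ji].
    by rewrite mxE !eqxx addr0 mulr1.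
  by rewrite mxE ji andbF mulr0.
by rewrite pairing_coords rpred_sum // => i _; rewrite rpredM ?intr_int.
Qed.

Lemma dual_lattice0 : D 0.
Proof. by apply/dual_latticeP => i; rewrite /coords mul0mx mxE rpred0. Qed.

Lemma dual_latticeB s t : D s -> D t -> D (s - t).
Proof.
move=> /dual_latticeP Ds /dual_latticeP Dt; apply/dual_latticeP => i.
by rewrite coordsB rpredB.
Qed.

Lemma scaled_dualP N t : (0 < N)%N ->
  scaled_dual N L t <-> forall i, N%:R * coords t i \is a Num.int.
Proof.
move=> N0; have N0' : N%:R != 0 :> R by rewrite pnatr_eq0 -lt0n.
split=> [[s /dual_latticeP Ds <-] i|Dt].
  by rewrite coordsZ mulrA mulfV ?mul1r.
exists (N%:R *: t); last by rewrite scalerA mulVf ?scale1r.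
by apply/dual_latticeP => i; rewrite coordsZ.
Qed.

Lemma normc_sqrE (z : R[i]) : ((Normc.normc z ^+ 2)%:C)%C = z * conjc z.
Proof. by rewrite -sqr_normc normc_def rmorphXn; case: z. Qed.

Local Notation pairs := [seq (a, b) | a <- A, b <- A].

(** Expanding [Dhat] times its conjugate leaves only differences [a - b]; this is W evaluated at the
    character defined by [t]. *)
Lemma normc_Dhat_sqr t : ((Normc.normc (Dhat A c t) ^+ 2)%:C)%C =
  \sum_(x <- pairs) (c x.1 * c x.2)%:R * turn (pairing t (x.1 - x.2)).
Proof.
have pairingB a b : pairing t (a - b) = pairing t a - pairing t b.
  rewrite -sumrB; apply: eq_bigr => i _.
  by rewrite !mxE rmorphB mulrBr.
rewrite normc_sqrE big_allpairs /Dhat rmorph_sum mulr_suml.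
apply: eq_bigr => a _; rewrite mulr_sumr; apply: eq_bigr => b _ /=.
rewrite -/(turn _) -/(turn _) pairingB turnD turnN rmorphM /= conjc_nat natrM.
by rewrite mulrACA.
Qed.

Lemma normc_Dhat_periodic s t : D (s - t) ->
  Normc.normc (Dhat A c s) ^+ 2 = Normc.normc (Dhat A c t) ^+ 2.
Proof.
move=> Dst; apply: complexI; rewrite !normc_Dhat_sqr !big_seq.
apply: eq_bigr => x /allpairsP[[a b] [/= aA bA ->]] /=; congr (_ * _).
apply: eq_turn; rewrite [X in X \is a _](_ : _ = pairing (s - t) (a - b)).
  exact/Dst/difference_lattice_sub.
by rewrite -sumrB; apply: eq_bigr => i _; rewrite -mulrBl !mxE.
Qed.

(** * Fixed level N: cosets as points of (Z/N)^n *)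

Section Level.
Variable p : nat.
Local Notation N := p.+1.
Local Notation G := {ffun 'I_n -> 'I_N}.

Definition torus_point (k : G) : 'rV[R]_n :=
  (\row_i ((k i)%:R / N%:R)) *m invmx (map_mx intr B)^T.

Lemma coords_torus_point k i : coords (torus_point k) i = (k i)%:R / N%:R.
Proof.
rewrite /coords mulmxKV ?mxE // unitmx_tr unitmxE det_map_mx unitfE.
by rewrite intr_eq0.
Qed.

Definition torus_value (k : G) : R := Normc.normc (Dhat A c (torus_point k)) ^+ 2.

Lemma torus_point_scaled k : scaled_dual N L (torus_point k).
Proof.
apply/scaled_dualP => // i.
by rewrite coords_torus_point mulrC divfK ?pnatr_eq0 // rpred_nat.
Qed.

(** Equal cosets make each [(k i - l i) / N] an integer; its absolute value is below 1, so it is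
    0. *)
Lemma torus_point_inj : injective (fun k => coset_of_set D (torus_point k)).
Proof.
move=> k l /(coset_of_set_eq dual_lattice0 dual_latticeB)/dual_latticeP kl.
apply/ffunP => i; have := kl i; rewrite coordsB !coords_torus_point.
rewrite -mulrBl => /intrP[m].
move=> /(canRL (divfK _)); rewrite pnatr_eq0 => /(_ isT) klm.
have : (k i : nat)%:Z - (l i : nat)%:Z = m * N.
  by apply: (@intr_inj R); rewrite rmorphB rmorphM.
move: (ltn_ord (k i)) (ltn_ord (l i)) => kN lN klN.
have m0 : m = 0 by nia.
by apply/val_inj; move: klN; rewrite m0 mul0r /=; lia.
Qed.

Lemma torus_point_surj t : scaled_dual N L t -> exists k, D (t - torus_point k).
Proof.
move=> /scaled_dualP - /(_ isT) Nt.
have /choice[z zP] i : exists m : int, N%:R * coords t i = m%:~R by apply/intrP/Nt.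
exists (residues p z); apply/dual_latticeP => i.
rewrite coordsB coords_torus_point.
have -> : coords t i = (z i)%:~R / N%:R.
  by rewrite -zP mulrAC mulfV ?mul1r // pnatr_eq0.
by rewrite -mulrBl residues_sub.
Qed.

(** Exhibits the cosets counted by [mult_N] as the image of a finite set, so [fset_set] does not
    fall back to the empty set. *)
Lemma spectral_cosetsE r :
  [set coset_of_set D t | t in
     scaled_dual N L `&` [set t | Normc.normc (Dhat A c t) ^+ 2 = r]]%classic =
  [set coset_of_set D (torus_point k) | k in
     [set` [fset k in [seq k <- index_enum G | torus_value k == r]]%fset]]%classic.
Proof.
apply/seteqP; split=> _ [x + <-].
  case=> /torus_point_surj[k Dk] /= xr; exists k => /=.
    rewrite inE /= mem_filter mem_index_enum andbT -xr; apply/eqP.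
    exact/esym/normc_Dhat_periodic.
  by apply/esym/(coset_of_set_eq dual_lattice0 dual_latticeB).
rewrite /= inE /= mem_filter => /andP[/eqP xr _].
by exists (torus_point x) => //; split; first exact: torus_point_scaled.
Qed.

Lemma finite_spectral_cosets r : finite_set
  [set coset_of_set D t | t in
     scaled_dual N L `&` [set t | Normc.normc (Dhat A c t) ^+ 2 = r]]%classic.
Proof. by rewrite spectral_cosetsE; apply/finite_image/finite_fset. Qed.

Lemma mult_N_count r :
  mult_N A c N r = count_mem r [seq torus_value k | k <- index_enum G].
Proof.
rewrite /mult_N /= spectral_cosetsE fset_set_image; last exact: finite_fset.
rewrite card_imfset /=; last exact: torus_point_inj.
rewrite set_fsetK card_imfset //.
rewrite -[LHS]/(size (undup [seq k <- index_enum G | torus_value k == r])).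
rewrite undup_id ?filter_uniq ?index_enum_uniq //.
by rewrite size_filter count_map.
Qed.

Lemma B_poly_prod : B_poly R A c N = \prod_(k : G) ('X - (torus_value k)%:P).
Proof.
(* Outside the list of values the multiplicity is zero; on it, each power unfolds into one factor
   per [k]. *)
rewrite /B_poly (fsbigE (undup [seq torus_value k | k <- index_enum G])) ?undup_uniq //.
  under eq_bigl do rewrite in_setT.
  under eq_bigr do rewrite mult_N_count.
  by rewrite prodr_undup_exp_count big_map.
by move=> r _; rewrite mem_undup mult_N_count => /count_memPn ->.
Qed.

Lemma B_poly_monic : B_poly R A c N \is monic.
Proof. by rewrite B_poly_prod monic_prod // => k _; rewrite monicXsubC. Qed.

Lemma B_poly_int : exists b : {poly int}, B_poly R A c N = map_poly intr b.
Proof.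
(* [e x] holds the coordinates of the difference in the basis [B], with dummy value 0 off the list
   of pairs. These are the exponents fed to [prod_char_int]. *)
have /choice[e eP] (x : 'rV[int]_n * 'rV[int]_n) :
    exists k : 'rV[int]_n, x \in pairs -> x.1 - x.2 = k *m B.
  have [/allpairsP[[a b] [/= aA bA ->]]|_] := boolP (x \in pairs); last by exists 0.
  by have /B_basis[k kP] := difference_lattice_sub aA bA; exists k.
have [b bP] := prod_char_int R p pairs (fun x => (c x.1 * c x.2)%N)
  (fun x => e x 0).
(* The character sums are complex, so the identity is checked after the injective embedding of [R]
   into [R[i]]. *)
exists b; apply: (map_inj_poly (f := real_complex R)) => //.
  exact: complexI.
rewrite -map_poly_comp (eq_map_poly (g := intr)); last first.
  by move=> z; rewrite /= rmorph_int.
rewrite bP B_poly_prod rmorph_prod; apply: eq_bigr => k _ /=.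
rewrite rmorphB /= map_polyX map_polyC /=; congr (_ - _%:P).
rewrite /torus_value normc_Dhat_sqr !big_seq; apply: eq_bigr => x xA.
rewrite eP // pairing_coords; congr (_ * turn _).
by apply: eq_bigr => i _; rewrite coords_torus_point.
Qed.

End Level.

(** * Comparison of two levels *)

Lemma mult_N_dvdn N M (r : R) : (0 < M)%N -> (N %| M)%N ->
  (mult_N A c N r <= mult_N A c M r)%N.
Proof.
move=> M0 NM; have N0 := dvdn_gt0 M0 NM.
apply: fsubset_leq_card; case: N N0 NM => // N _; case: M M0 => // M _ NM.
(* Monotonicity of [fset_set] relies on both sets being finite. The inclusion holds because [N * x]
   integral implies [M * x] integral. *)
rewrite -fset_set_sub; try exact: finite_spectral_cosets.
apply: image_subset => t [/scaled_dualP-/(_ isT) Nt tr]; split=> //.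
apply/scaled_dualP => // i; have /dvdnP[q ->] := NM.
by rewrite natrM -mulrA rpredM ?rpred_nat.
Qed.

Lemma B_poly_dvd N M : (0 < M)%N -> (N %| M)%N ->
  exists Q : {poly R}, B_poly R A c M = Q * B_poly R A c N.
Proof.
move=> M0 NM; have le_mult (r : R) : (mult_N A c N r <= mult_N A c M r)%N by exact: mult_N_dvdn.
case: M M0 NM le_mult => // m _ NM le_mult.
pose s := undup [seq torus_value k | k <- index_enum {ffun 'I_n -> 'I_m.+1}].
have mult0 (r : R) : r \notin s -> mult_N A c m.+1 r = 0%N.
  by rewrite mem_undup mult_N_count => /count_memPn ->.
(* Both products are written over the values at the larger level, so that exponents can be
   subtracted factor by factor. *)
have BE K : (forall r : R, (mult_N A c K r <= mult_N A c m.+1 r)%N) ->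
    B_poly R A c K = \prod_(r <- s) ('X - r%:P) ^+ mult_N A c K r.
  move=> le_m; rewrite /B_poly (fsbigE s) ?undup_uniq //.
    by under eq_bigl do rewrite in_setT.
  by move=> r _ /mult0 r0; have := le_m r; rewrite r0 leqn0 => /eqP ->.
exists (\prod_(r <- s) ('X - r%:P) ^+ (mult_N A c m.+1 r - mult_N A c N r)).
rewrite !BE // -big_split /=; apply: eq_bigr => r _.
by rewrite -exprD subnK.
Qed.

End DualLattice.

Theorem proposition2 (R : realType) (n : nat) (A : {fset 'rV[int]_n})
    (c : 'rV[int]_n -> nat)
    (hn : (1 <= n)%N)
    (hc : forall a, a \in A -> (0 < c a)%N)
    (hrank : has_Zrank (difference_lattice A) n) :
  (forall N : nat, (0 < N)%N -> B_poly R A c N \is a polyOver Num.int) /\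
  (forall N N' : nat, (0 < N)%N -> (0 < N')%N -> (N' %| N)%N ->
     exists2 Q : {poly R}, Q \is a polyOver Num.int &
       B_poly R A c N = Q * B_poly R A c N').
Proof.
have [B [B0 B_basis]] := difference_lattice_basis hrank; split=> [[//|p] _|].
  have [b ->] := B_poly_int R c B0 B_basis p.
  by apply/polyOverP => i; rewrite coef_map intr_int.
move=> [//|m] [//|p] m0 _ pm.
have [Q BQ] := B_poly_dvd R c B0 B_basis m0 pm; exists Q => //.
have [b bE] := B_poly_int R c B0 B_basis m.
have [d dE] := B_poly_int R c B0 B_basis p.
apply: (@int_poly_quotient _ b d); rewrite -dE -?bE //.
exact: B_poly_monic B0 B_basis _.
Qed.
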